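(* Let $0<q<2$ and $r\in(0,1)$. For the $q$-binomial distribution $b_q(k;n,r)$ (with $n,k\in\mathbb{N}$, $k\le n$), the following asymptotic expansion holds for large $n$: $$\ln_q b_q(k;n,r) = -\frac{n^{2-q}}{2-q}\,D_{2-q}(\mathbf{p}\,\|\,\mathbf{r}) + \ln_q C_q + O(\ln_q n),$$ where $\mathbf{p}=(p_0,p_1):=\left(\frac{k}{n},1-\frac{k}{n}\right)$, $\mathbf{r}=(r_0,r_1):=(r,1-r)$, $C_q$ is the normalization constant in the definition of $b_q(k;n,r)$, and $D_{q}(\mathbf{p}\,\|\,\mathbf{r})$ denotes the $q$-divergence $$D_q(\mathbf{p}\,\|\,\mathbf{r}) := \sum_{i=0}^{1} p_i \ln_{2-q}\frac{p_i}{r_i} = \frac{1-\sum_{i=0}^{1} p_i^{q} r_i^{1-q}}{1-q}.$$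
   Context: For $s\in\mathbb{R}$ and $x>0$ the $s$-logarithm is $\ln_s x := \frac{x^{1-s}-1}{1-s}$ (for $s=1$: $\ln_1 x=\ln x$; expressions at $s=1$ are understood as limits, e.g. the $q$-divergence at index $1$ is the Kullback-Leibler divergence). The $q$-factorial $n!_q$ is handled through its $q$-logarithm: $\ln_q n!_q=\sum_{j=1}^{n}\ln_q j$ (it comes from the $q$-product $x\otimes_q y:=[x^{1-q}+y^{1-q}-1]^{1/(1-q)}$ via $n!_q:=1\otimes_q 2\otimes_q\cdots\otimes_q n$). The $q$-binomial coefficient is defined through its $q$-logarithm by $\ln_q\binom{n}{k}_q := \ln_q n!_q-\ln_q k!_q-\ln_q (n-k)!_q$. For $n,k\in\mathbb{N}$ with $k\le n$ and $r\in(0,1)$, the $q$-binomial distribution $b_q(k;n,r)$ is defined through its $q$-logarithm: $$\ln_q b_q(k;n,r) := \ln_q\binom{n}{k}_q+\frac{1}{2-q}\left(k^{2-q}\ln_{2-q} r+(n-k)^{2-q}\ln_{2-q}(1-r)\right)+\ln_q C_q,$$ where $C_q>0$ is a normalization constant ensuring $\sum_{k=0}^n b_q(k;n,r)=1$, with $C_1=1$. *)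

(* Defs.v *)
From HB Require Import structures.
From mathcomp Require Import all_boot all_order all_algebra.
From mathcomp Require Import all_classical all_reals all_analysis.
From mathcomp Require Import ring.

Set Implicit Arguments.
Unset Strict Implicit.
Unset Printing Implicit Defensive.

Import Order.TTheory GRing.Theory Num.Theory.

Local Open Scope ring_scope.

Definition slog (R : realType) (s x : R) : R :=
  if s == 1 then ln x else (x `^ (1 - s) - 1) / (1 - s).

(* The q-factorial and the q-binomial coefficient are handled only through
   their q-logarithms: for q > 1 the bracket in the iterated q-product can be
   nonpositive, so that n!_q itself need not exist as a real number. *)
Definition lnq_fact (R : realType) (q : R) (n : nat) : R :=
  \sum_(1 <= j < n.+1) slog q j%:R.

Definition lnq_binom (R : realType) (q : R) (n k : nat) : R :=
  lnq_fact q n - lnq_fact q k - lnq_fact q (n - k).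

(* [lnq_qbinom q r C n k] is ln_q b_q(k; n, r), with C the value of C_q for
   this n.  As 0 `^ (2 - q) = 0 for q < 2, the end points k = 0 and k = n are
   covered by the same formula. *)
Definition lnq_qbinom (R : realType) (q r C : R) (n k : nat) : R :=
  lnq_binom q n k
  + (2 - q)^-1 * (k%:R `^ (2 - q) * slog (2 - q) r
                  + (n - k)%:R `^ (2 - q) * slog (2 - q) (1 - r))
  + slog q C.

(* [b] is the q-binomial distribution on {0, ..., n}, with normalization
   constant [C].  For q < 1 the q-logarithm maps the positive reals onto
   ]-1/(1-q), +oo[ only; a prescribed value at or below this range stands for
   b k = 0, which is the usual cut-off of the q-exponential.  Without it no C
   normalizes the distribution when q < 1 and n is large.  For q > 1 the range
   is ]-oo, 1/(q-1)[, and values outside of it are excluded. *)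
Definition is_qbinomial (R : realType) (q r C : R) (n : nat) (b : nat -> R) :
    Prop :=
  [/\ 0 < C,
      q = 1 -> C = 1,
      forall k : nat, (k <= n)%N ->
        (0 < b k /\ slog q (b k) = lnq_qbinom q r C n k) \/
        [/\ b k = 0, q < 1 & lnq_qbinom q r C n k <= - (1 - q)^-1]
    & \sum_(k < n.+1) b k = 1].

Definition bern (R : realType) (x : R) : 'I_2 -> R :=
  fun i => if i == ord0 then x else 1 - x.

(* A term with p i = 0 contributes 0, and s = 1 gives the Kullback-Leibler
   divergence. *)
Definition qdiv (R : realType) (s : R) (p r : 'I_2 -> R) : R :=
  \sum_(i < 2) p i * slog (2 - s) (p i / r i).

Lemma qdivE (R : realType) (s : R) (p r : 'I_2 -> R) :
  0 < s -> s != 1 -> (forall i, 0 <= p i) -> \sum_(i < 2) p i = 1 ->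
  (forall i, 0 < r i) ->
  qdiv s p r = (1 - \sum_(i < 2) p i `^ s * r i `^ (1 - s)) / (1 - s).
Proof.
move=> s0 s1 p0 p1 r0.
have s1' : 1 - s != 0 by rewrite subr_eq0 eq_sym.
have s2 : s - 1 != 0 by rewrite subr_eq0.
rewrite /qdiv -[X in X - \sum_(i < 2) _]p1 -sumrB mulr_suml.
apply: eq_bigr => i _.
have -> : p i `^ s * r i `^ (1 - s) = p i * (p i / r i) `^ (s - 1).
  have [->|pi0] := eqVneq (p i) 0.
    by rewrite mul0r powR0 ?mul0r // gt_eqF.
  have pp : 0 < p i by rewrite lt_neqAle eq_sym pi0 p0.
  rewrite powRM ?p0 ?invr_ge0 ?(ltW (r0 i)) // mulrA.
  rewrite -{2}(powRr1 (p0 i)) -powRD; last by rewrite pi0 implybT.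
  rewrite addrCA subrr addr0; congr (_ * _).
  by rewrite -powR_inv1 ?(ltW (r0 i)) // -powRrM mulN1r opprB.
rewrite /slog ifF; last first.
  apply/negP => /eqP h; move: s1' => /eqP; apply.
  have -> : 1 - s = (2 - s) - 1 by ring.
  by rewrite h subrr.
have -> : 1 - (2 - s) = s - 1 by ring.
by field; rewrite s1' s2.
Qed.

(* Main.v *)
Require Import Defs.
From HB Require Import structures.
From mathcomp Require Import all_boot all_order all_algebra.
From mathcomp Require Import all_classical all_reals all_analysis.
From mathcomp Require Import ring lra.

(** The function [F x = x (ln_q x - 1) / (2 - q)] is a primitive of [ln_q] on
    the positive reals, for every [q < 2] and [q = 1] included.  Replace each
    [ln_q m!_q] in [ln_q b_q(k; n, r)] by [F m].

    - What comes out is exactly the stated main term, with no remainder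
      ([slog_prim_qdiv]): the linear parts of [F n - F k - F (n - k)] cancel,
      and the rest regroups, by [ln_q (x y) = ln_q x + x^(1-q) ln_q y], into
      one multiple of [p_i ln_q (p_i / r_i)] for each of the two outcomes.

    - The cost of one replacement is [ln_q m!_q - F m].  As [ln_q] increases,
      the sum of the [ln_q j] for [j <= m] differs from the integral of [ln_q]
      over [[1, m]] by at most its last term, so the cost lies between [0] and
      [ln_q m + 1/(2-q)] for [m >= 1] ([slog_prim_le_lnq_fact],
      [lnq_fact_le_slog_prim]), while it is [0] for [m = 0]; for [m <= n] it is
      thus at most [ln_q n + 1/(2-q)].

    The constant [1/(2-q)] is absorbed in the multiple of [ln_q n] because
    [ln_q n >= ln_q 2 > 0] for [n >= 2]; for [q > 1] this matters, as [ln_q] is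
    then bounded. *)

Set Implicit Arguments.
Unset Strict Implicit.
Unset Printing Implicit Defensive.

Import Order.TTheory GRing.Theory Num.Theory.

Local Open Scope classical_set_scope.
Local Open Scope ring_scope.

Lemma slog1 (R : realType) (q : R) : slog q 1 = 0.
Proof. by rewrite /slog ln1 powR1 subrr mul0r if_same. Qed.

(** Clearing the denominator makes the power [x^(1-q)] an affine function of
    [ln_q x], valid at [q = 1] too; this is what lets the rest of the proof
    ignore that case. *)
Lemma powR_slog (R : realType) (q x : R) :
  x `^ (1 - q) = 1 + (1 - q) * slog q x.
Proof.
rewrite /slog; have [->|q1] := eqVneq q 1.
  by rewrite subrr powRr0 mul0r addr0.
have q1' : 1 - q != 0 by rewrite subr_eq0 eq_sym.
by field.
Qed.

Lemma slogM (R : realType) (q x y : R) : 0 < x -> 0 < y ->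
  slog q (x * y) = slog q x + x `^ (1 - q) * slog q y.
Proof.
move=> x0 y0; rewrite /slog; have [->|q1] := eqVneq q 1.
  by rewrite subrr powRr0 mul1r lnM.
have q1' : 1 - q != 0 by rewrite subr_eq0 eq_sym.
by rewrite powRM ?ltW//; field.
Qed.

(** The inverse exchanges the indices [q] and [2 - q]: this is why [ln_(2-q)]
    of the probabilities enters the definition of the distribution. *)
Lemma slogV (R : realType) (q x : R) : 0 < x ->
  slog q x^-1 = - slog (2 - q) x.
Proof.
move=> x0; rewrite /slog.
have -> : (2 - q == 1) = (q == 1) by apply/eqP/eqP; lra.
have [_|q1] := eqVneq q 1; first by rewrite lnV.
have q1' : 1 - q != 0 by rewrite subr_eq0 eq_sym.
have -> : 1 - (2 - q) = - (1 - q) by ring.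
rewrite -powR_inv1 ?ltW// -powRrM mulN1r.
by field.
Qed.

Lemma is_derive_slog (R : realType) (q x : R) : 0 < x ->
  is_derive x 1 (slog q) (x `^ (- q)).
Proof.
move=> x0; have [->|q1] := eqVneq q 1.
  have -> : slog 1 = @ln R by apply/funext => y; rewrite /slog eqxx.
  by rewrite powR_inv1 ?ltW//; exact: is_derive1_ln.
have q1' : 1 - q != 0 by rewrite subr_eq0 eq_sym.
have -> : slog q = (1 - q)^-1 \*: ((fun x : R => x `^ (1 - q)) - cst 1) :> (R -> R).
  by apply/funext => y; rewrite /slog (negPf q1) mulrC.
have D := is_derive1_powR (1 - q) x0.
apply: is_derive_eq.
rewrite /GRing.scale/= subr0 mulrA mulVf// mul1r; congr (_ `^ _); ring.
Qed.

(** The mean value theorem on the positive half-line, where the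
    differentiability of [f] also provides its continuity. *)
Lemma MVT_gt0 (R : realType) (f df : R -> R) (x y : R) :
  (forall z : R, 0 < z -> is_derive z 1 f (df z)) -> 0 < x -> x < y ->
  exists2 c, x < c < y & f y - f x = df c * (y - x).
Proof.
move=> Df x0 xy; have [z||c] := @MVT R f df x y xy.
- by rewrite in_itv/= => /andP[xz _]; apply: Df; exact: lt_trans xz.
- apply: derivable_within_continuous => z; rewrite in_itv/= => /andP[xz _].
  by have [] := Df z (lt_le_trans x0 xz).
- by rewrite in_itv/= => cxy E; exists c.
Qed.

Lemma slog_lt (R : realType) (q x y : R) : 0 < x -> x < y ->
  slog q x < slog q y.
Proof.
move=> x0 xy; rewrite -subr_gt0.
have [c /andP[xc _] ->] := MVT_gt0 (is_derive_slog q) x0 xy.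
by rewrite mulr_gt0 ?subr_gt0// powR_gt0// (lt_trans x0).
Qed.

Lemma slog_le (R : realType) (q x y : R) : 0 < x -> x <= y ->
  slog q x <= slog q y.
Proof.
move=> x0; rewrite le_eqVlt => /predU1P[->//|xy].
by rewrite ltW// slog_lt.
Qed.

(** The multiple of [x] in this primitive of [ln_q] is chosen to make it vanish
    at [0], like the empty sum [ln_q 0!_q]; at [q = 1] it is [x ln x - x]. *)
Definition slog_prim (R : realType) (q x : R) : R :=
  x * (slog q x - 1) / (2 - q).

Lemma is_derive_slog_prim (R : realType) (q x : R) : q < 2 -> 0 < x ->
  is_derive x 1 (slog_prim q) (slog q x).
Proof.
move=> q2 x0; have q2' : 2 - q != 0 by rewrite gt_eqF// subr_gt0.
have -> : slog_prim q = (2 - q)^-1 \*: (id * (slog q - cst 1)) :> (R -> R).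
  by apply/funext => y; rewrite /slog_prim mulrC.
have D := is_derive_slog q x0.
apply: is_derive_eq.
rewrite /GRing.scale/= subr0 mulr1.
have -> : x * x `^ (- q) = 1 + (1 - q) * slog q x.
  rewrite -powR_slog -{1}(powRr1 (ltW x0)) -powRD//.
  by rewrite (gt_eqF x0) implybT.
rewrite -[(_ - _) x]/(slog q x - 1).
by field.
Qed.

Lemma slog_prim0 (R : realType) (q : R) : slog_prim q 0 = 0.
Proof. by rewrite /slog_prim !mul0r. Qed.

Lemma slog_prim1 (R : realType) (q : R) : slog_prim q 1 = - (2 - q)^-1.
Proof. by rewrite /slog_prim slog1 mul1r sub0r mulN1r. Qed.

(** Comparison of one term of the sum with the integral of [ln_q] over an
    interval of length one. *)
Lemma slog_prim_step (R : realType) (q : R) (m : nat) : q < 2 -> (0 < m)%N ->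
  slog q m%:R <= slog_prim q m.+1%:R - slog_prim q m%:R <= slog q m.+1%:R.
Proof.
move=> q2 m0; have m0' : 0 < m%:R :> R by rewrite ltr0n.
have lt_mS : m%:R < m.+1%:R :> R by rewrite ltr_nat.
have [c /andP[mc cm] ->] :=
  MVT_gt0 (fun z => is_derive_slog_prim (x := z) q2) m0' lt_mS.
rewrite -natr1 addrAC subrr add0r mulr1 natr1.
have c0 : 0 < c by exact: lt_trans mc.
by rewrite !slog_le // ltW.
Qed.

Lemma lnq_fact0 (R : realType) (q : R) : lnq_fact q 0 = 0.
Proof. by rewrite /lnq_fact big_geq. Qed.

Lemma lnq_factS (R : realType) (q : R) (m : nat) :
  lnq_fact q m.+1 = lnq_fact q m + slog q m.+1%:R.
Proof. by rewrite /lnq_fact big_nat_recr. Qed.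

Lemma slog_prim_le_lnq_fact (R : realType) (q : R) (m : nat) : q < 2 ->
  slog_prim q m%:R <= lnq_fact q m.
Proof.
move=> q2; elim: m => [|[|m] IH]; first by rewrite lnq_fact0 slog_prim0.
  rewrite lnq_factS lnq_fact0 slog1 addr0 slog_prim1.
  by rewrite oppr_le0 invr_ge0 subr_ge0 ltW.
have /andP[_] := slog_prim_step (m := m.+1) q2 isT.
by rewrite lnq_factS; lra.
Qed.

Lemma lnq_fact_le_slog_prim (R : realType) (q : R) (m : nat) :
  q < 2 -> (0 < m)%N ->
  lnq_fact q m <= slog_prim q m%:R + slog q m%:R + (2 - q)^-1.
Proof.
move=> q2; case: m => // m _; elim: m => [|m IH].
  by rewrite lnq_factS lnq_fact0 slog_prim1 slog1; lra.
have /andP[+ _] := slog_prim_step (m := m.+1) q2 isT.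
by rewrite lnq_factS; lra.
Qed.

Lemma lnq_fact_slog_prim (R : realType) (q : R) (m n : nat) :
  q < 2 -> (0 < n)%N -> (m <= n)%N ->
  0 <= lnq_fact q m - slog_prim q m%:R <= slog q n%:R + (2 - q)^-1.
Proof.
move=> q2 n0 mn; rewrite subr_ge0 slog_prim_le_lnq_fact//=.
have [->|m0] := posnP m.
  rewrite lnq_fact0 slog_prim0 subrr addr_ge0 ?invr_ge0 ?subr_ge0 ?(ltW q2)//.
  by rewrite -(slog1 q) slog_le// ler1n.
have := lnq_fact_le_slog_prim q2 m0.
have : slog q m%:R <= slog q n%:R by rewrite slog_le ?ltr0n// ler_nat.
by lra.
Qed.

(** The contribution of one outcome, observed [x] times out of [y] and of
    probability [r].  For [x > 0] it follows from writing [x = y (x / y)] and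
    [x / y / r = (x / y) r^-1] and applying [slogM] to both. *)
Lemma slog_outcome (R : realType) (q r x y : R) :
  q < 2 -> 0 < r -> 0 <= x -> 0 < y ->
  x * (slog q y - slog q x) + x `^ (2 - q) * slog (2 - q) r =
  - (y `^ (2 - q) * (x / y * slog q (x / y / r))).
Proof.
move=> q2 r0 x0 y0.
have powS z : 0 <= z -> z `^ (2 - q) = z * z `^ (1 - q).
  move=> z0; rewrite -(mulr_powRB1 z0) ?subr_gt0//.
  by congr (_ * _ `^ _); ring.
move: x0; rewrite le_eqVlt => /predU1P[<-|x0].
  by rewrite powS// !mul0r mulr0 oppr0 addr0.
have p0 : 0 < x / y by rewrite divr_gt0.
have y0' : y != 0 by rewrite gt_eqF.
have Ex : x = y * (x / y) by field.
rewrite !powS ?ltW// slogM ?invr_gt0// slogV//.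
rewrite {2 4}Ex slogM// powRM ?ltW//.
by field.
Qed.

(** The main term is exact once the q-factorials are replaced by the
    primitive. *)
Lemma slog_prim_qdiv (R : realType) (q r : R) (n k : nat) :
  q < 2 -> 0 < r -> r < 1 -> (0 < n)%N -> (k <= n)%N ->
  slog_prim q n%:R - slog_prim q k%:R - slog_prim q (n - k)%:R
    + (2 - q)^-1 * (k%:R `^ (2 - q) * slog (2 - q) r
                    + (n - k)%:R `^ (2 - q) * slog (2 - q) (1 - r)) =
  - (n%:R `^ (2 - q) / (2 - q)) * qdiv (2 - q) (bern (k%:R / n%:R)) (bern r).
Proof.
move=> q2 r0 r1 n0 kn.
have q2' : 2 - q != 0 by rewrite gt_eqF// subr_gt0.
have n0' : 0 < n%:R :> R by rewrite ltr0n.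
rewrite /qdiv big_ord_recl big_ord1 /bern/=.
have -> : 2 - (2 - q) = q by ring.
have -> : 1 - k%:R / n%:R = (n - k)%:R / n%:R :> R.
  by rewrite natrB//; field; rewrite gt_eqF.
have r1' : 0 < 1 - r by rewrite subr_gt0.
have := slog_outcome q2 r0 (ler0n R k) n0'.
have := slog_outcome q2 r1' (ler0n R (n - k)) n0'.
set Y := _ / n%:R * _ => EY; set X := _ / n%:R * _ => EX.
transitivity ((- (n%:R `^ (2 - q) * X) - n%:R `^ (2 - q) * Y) / (2 - q)).
  by rewrite -EX -EY /slog_prim natrB//; field.
by field.
Qed.

Theorem theorem11 (R : realType) (q r : R) (q_gt0 : 0 < q) (q_lt2 : q < 2)
    (r_gt0 : 0 < r) (r_lt1 : r < 1) :
  exists K : R, \forall n \near \oo,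
    forall (k : nat) (C : R) (b : nat -> R),
      (k <= n)%N -> is_qbinomial q r C n b ->
      `| lnq_qbinom q r C n k
         - (- (n%:R `^ (2 - q) / (2 - q))
              * qdiv (2 - q) (bern (k%:R / n%:R)) (bern r)
            + slog q C) |
        <= K * `| slog q n%:R |.
Proof.
have l2_gt0 : 0 < slog q 2 by rewrite -(slog1 q) slog_lt// ltr1n.
set d := (2 - q)^-1; have d_ge0 : 0 <= d by rewrite invr_ge0 subr_ge0 ltW.
(* Twice the largest possible cost [ln_q n + d], where [d <= d ln_q n / ln_q 2]:
   three costs, all nonnegative, enter with the signs [+], [-], [-]. *)
exists (2 * (1 + d / slog q 2)); exists 2%N => // n /= n2 k C b kn _.
have n0 : (0 < n)%N by exact: leq_trans n2.
have l2n : slog q 2 <= slog q n%:R by rewrite slog_le// ler_nat.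
rewrite (ger0_norm (le_trans (ltW l2_gt0) l2n)).
have d_le : d <= d / slog q 2 * slog q n%:R.
  by rewrite mulrAC -mulrA ler_peMr// ler_pdivlMr// mul1r.
rewrite -slog_prim_qdiv// /lnq_qbinom /lnq_binom -/d.
have /andP[n_ge n_le] := lnq_fact_slog_prim q_lt2 n0 (leqnn n).
have /andP[k_ge k_le] := lnq_fact_slog_prim q_lt2 n0 kn.
have /andP[j_ge j_le] := lnq_fact_slog_prim q_lt2 n0 (leq_subr k n).
rewrite -/d in n_le k_le j_le.
rewrite ler_norml; apply/andP; split; lra.
Qed.
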